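(* Let $d\geq 1$ and $n\geq 1$ be integers, let $G$ be a $d$--regular bipartite graph on $v(G)=2n$ vertices, let $0\leq k\leq n$ be an integer, and let $m_k(G)$ denote the number of matchings of size $k$ in $G$. Put $p=\frac{k}{n}$ and $$p_{\mu}={n\choose k}p^k(1-p)^{n-k},$$ the probability that a Binomial$(n,p)$ random variable takes its mean value $k$. Then $$m_k(G)\geq p_{\mu}\exp\big(2n\,\mathcal{G}_d(p)\big).$$ In particular $$m_k(G)\geq {n\choose k}^2\left(\frac{d-p}{d}\right)^{n(d-p)}(dp)^{np}.$$ Furthermore, for every $0\leq k<n$ there exists a $d$--regular bipartite graph $G$ on $2n$ vertices such that, with $p=k/n$, $$m_k(G)\leq \sqrt{\frac{1-p/d}{1-p}}\cdot p_{\mu}\exp\big(2n\,\mathcal{G}_d(p)\big).$$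
   Context: For a positive integer $d$ and $0\leq p\leq 1$, $$\mathcal{G}_d(p)=\frac{1}{2}\left(p\ln\left(\frac{d}{p}\right)+(d-p)\ln\left(1-\frac{p}{d}\right)-2(1-p)\ln(1-p)\right),$$ with the convention $0\ln(\cdot)=0$ (i.e. $0\ln 0=0$, $0\ln(d/0)=0$). A matching of size $k$ is a set of $k$ pairwise vertex-disjoint edges; $m_0(G)=1$. Note the identity ${n\choose k}^2\left(\frac{d-p}{d}\right)^{n(d-p)}(dp)^{np}=p_\mu^2\exp(2n\mathcal{G}_d(p))$. *)

(* Defs.v *)
From mathcomp Require Import all_boot.
From Stdlib Require Import Reals.

Set Implicit Arguments.
Unset Strict Implicit.
Unset Printing Implicit Defensive.

(* A bipartite multigraph with colour classes 'I_n (left) and 'I_n (right):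
   a finite type of edges E with left endpoint [l e] and right endpoint [r e].
   Parallel edges are allowed (distinct elements of E). *)

Definition regular_bip (n d : nat) (E : finType) (l r : E -> 'I_n) : Prop :=
  (forall i : 'I_n, #|[set e : E | l e == i]| = d) /\
  (forall j : 'I_n, #|[set e : E | r e == j]| = d).

Definition is_matching (n : nat) (E : finType) (l r : E -> 'I_n) (M : {set E}) : bool :=
  [forall e in M, forall f in M, (e != f) ==> ((l e != l f) && (r e != r f))].

Definition num_matchings (n : nat) (E : finType) (l r : E -> 'I_n) (k : nat) : nat :=
  #|[set M : {set E} | is_matching l r M && (#|M| == k)]|.

Open Scope R_scope.

Definition xln (a b : R) : R := if Req_EM_T a 0 then 0 else a * ln b.

Definition Gd (d : nat) (p : R) : R :=
  / 2 * (xln p (INR d / p) + xln (INR d - p) (1 - p / INR d)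
         - 2 * xln (1 - p) (1 - p)).

Definition p_mu (n k : nat) (p : R) : R :=
  INR 'C(n, k) * p ^ k * (1 - p) ^ (n - k).

Close Scope R_scope.

(* Main.v *)
Require Import Defs.
From Stdlib Require Import Reals.
From mathcomp Require Import all_boot all_order all_fingroup all_algebra.
From mathcomp Require Import ring lra zify.
From mathcomp Require Import reals Rstruct Rstruct_topology sequences exp.

(** Lower bound. Write p = k/n, a = p/d, and add n - k extra right vertices
    joined to every left vertex: they absorb the left vertices missed by a
    matching of size k. Cut each edge e of G into two pendant half-edges with
    free weights y_e and z_e. In this split graph, AM-GM bounds the matching
    polynomial from below by a constant times the product of all (y_e z_e)^a.
    Gluing the halves of one edge turns A + B y + C z + D y z into A + D, where
    AD >= BC by a correlation inequality for two opposite vertices of a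
    bipartite graph; under that condition the bound survives with its constant
    multiplied by a^a (1-a)^(1-a). Gluing all nd edges gives exactly
    p_mu exp(2n G_d(p)); this is the capacity argument of Gurvits and of
    Anari and Oveis Gharan. The second bound follows since p_mu <= 1.

    Upper bound. Pairing the half-edges at the left vertices with those at the
    right vertices by a uniformly random permutation gives C(n,k)^2 d^(2k) /
    C(nd,k) matchings of size k on average. This is at most the required bound
    because sqrt(1 - k/N) P(Binomial(N, k/N) = k) increases with N, which
    compares N = n with N = nd. *)

Set Implicit Arguments.
Unset Strict Implicit.
Unset Printing Implicit Defensive.
Import Order.TTheory GRing.Theory Num.Theory.
Local Open Scope ring_scope.

(** * Inequalities *)

Section Inequalities.
Variable R : realType.

(** Apply 1 + t <= exp t at t = ln (x i / (S lam i)) and weight by [lam i]; the errors x i / S - lam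
    i sum to 0. *)
Lemma weighted_amgm_ln (I : finType) (P : pred I) (lam x : I -> R) :
  (forall i, P i -> 0 <= lam i) -> (forall i, P i -> 0 < x i) ->
  \sum_(i | P i) lam i = 1 ->
  \sum_(i | P i) lam i * (ln (x i) - ln (lam i)) <= ln (\sum_(i | P i) x i).
Proof.
move=> lam_ge0 x_gt0 lam1; set S := \sum_(i | P i) x i.
have S_gt0 : 0 < S.
  rewrite lt_def sumr_ge0 ?andbT => [|i Pi]; last exact/ltW/x_gt0.
  apply/eqP => /psumr_eq0P S0; have /eqP := oner_neq0 R; apply.
  rewrite -lam1 big_pred0 // => i; apply/negbTE/negP => Pi.
  by have := x_gt0 i Pi; rewrite S0 ?ltxx // => j /x_gt0/ltW.
suff le_i i : P i -> lam i * (ln (x i) - ln (lam i)) <=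
                     lam i * ln S + (x i / S - lam i).
  apply: (le_trans (ler_sum _ le_i)); rewrite big_split /= -mulr_suml lam1 mul1r.
  by rewrite sumrB lam1 -mulr_suml divff ?gt_eqF // subrr addr0.
move=> Pi; have [lam0|lam_neq0] := eqVneq (lam i) 0.
  by rewrite lam0 !mul0r add0r subr0 divr_ge0 // ltW // x_gt0.
have lam_gt0 : 0 < lam i by rewrite lt_def lam_neq0 lam_ge0.
have xi_gt0 := x_gt0 i Pi.
have q_gt0 : 0 < x i / S / lam i by rewrite !divr_gt0.
have := expR_ge1Dx (ln (x i / S / lam i)); rewrite lnK ?posrE //.
rewrite !ln_div ?posrE ?divr_gt0 // => le_q.
have := ler_wpM2l (ltW lam_gt0) le_q.
by rewrite [lam i * (x i / S / _)]mulrC divfK //; lra.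
Qed.

(** This is a^a (1 - a)^(1 - a), with value 1 at a = 1. *)
Definition entropy_factor (a : R) : R := expR (a * ln a + (1 - a) * ln (1 - a)).

(** If B > 0, only C has to grow, to A D / B. If B = 0, the value C + 1 is positive even when C = 0,
    and it dictates the other factor. *)
Lemma upper_factorization (A B C D : R) : 0 < A -> 0 < D -> 0 <= B -> 0 <= C ->
  B * C <= A * D ->
  exists B' C', [/\ 0 < B', 0 < C', B <= B', C <= C' & B' * C' = A * D].
Proof.
move=> A0 D0 B0 C0 leBC; have AD0 : 0 < A * D by rewrite mulr_gt0.
have [B_eq0|B_neq0] := eqVneq B 0; last first.
  have Bgt0 : 0 < B by rewrite lt_def B_neq0.
  exists B, (A * D / B); split=> //; first by rewrite divr_gt0.
    by rewrite ler_pdivlMr // mulrC.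
  by rewrite mulrC divfK.
exists (A * D / (C + 1)), (C + 1); have C1 : 0 < C + 1 by lra.
split=> //; rewrite ?divr_gt0 //; last by rewrite divfK ?gt_eqF.
  by rewrite B_eq0 ltW ?divr_gt0.
by lra.
Qed.

(* Raise B and C until B C = A D and evaluate the hypothesis where
   B e^x = C e^y = (a / (1 - a)) A; weighted AM-GM concludes. *)
Lemma contraction_pos (a A B C D c : R) : 0 < a < 1 -> 0 < A -> 0 < D ->
  0 <= B -> 0 <= C -> B * C <= A * D ->
  (forall x y, c * expR (a * (x + y)) <=
     A + B * expR x + C * expR y + D * expR (x + y)) ->
  c * entropy_factor a <= A + D.
Proof.
move=> /andP[a0 a1] A0 D0 B0 C0 leBC hc.
have [B' [C' [B'0 C'0 leB leC BC]]] := upper_factorization A0 D0 B0 C0 leBC.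
have a1' : 0 < 1 - a by lra.
set q := a / (1 - a); have q0 : 0 < q by rewrite divr_gt0.
have yB : 0 < q * A / B' by rewrite divr_gt0 // mulr_gt0.
have zC : 0 < q * A / C' by rewrite divr_gt0 // mulr_gt0.
have := hc (ln (q * A / B')) (ln (q * A / C')).
rewrite [expR (ln _ + ln _)]expRD !lnK ?posrE // => le1.
have le2 : c * expR (a * (ln (q * A / B') + ln (q * A / C'))) <= A / (1 - a) ^+ 2.
  apply: le_trans le1 _.
  (* The four terms are A, q A, q A and q^2 A, and 1 + q = 1 / (1 - a). *)
  have -> : A / (1 - a) ^+ 2 =
      A + B' * (q * A / B') + C' * (q * A / C') + D * (q * A / B' * (q * A / C')).
    have -> : D * (q * A / B' * (q * A / C')) = q ^+ 2 * A * (A * D) / (B' * C').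
      by field; rewrite !gt_eqF.
    rewrite BC mulfK ?gt_eqF ?mulr_gt0 // /q; field.
    by rewrite !gt_eqF.
  by rewrite !lerD // ler_wpM2r // ltW.
have lnyz : ln (q * A / B') + ln (q * A / C') = 2 * (ln a - ln (1 - a)) + ln A - ln D.
  have lnq : ln q = ln a - ln (1 - a) by rewrite /q ln_div ?posrE.
  clearbody q; rewrite -lnM ?posrE //.
  have -> : q * A / B' * (q * A / C') = q ^+ 2 * (A * (A / (B' * C'))).
    by field; rewrite !gt_eqF.
  rewrite BC; have -> : A * (A / (A * D)) = A / D by field; rewrite !gt_eqF.
  rewrite expr2 !lnM ?posrE ?mulr_gt0 ?invr_gt0 // lnV ?posrE //.
  by rewrite lnq; ring.
have le3 : c * entropy_factor a <= expR (a * (ln D - ln a) + (1 - a) * (ln A - ln (1 - a))).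
  have -> : entropy_factor a =
    expR (a * (ln (q * A / B') + ln (q * A / C'))) *
    expR (a * (ln D - ln A) + a * (2 * ln (1 - a) - ln a) + (1 - a) * ln (1 - a)).
    by rewrite lnyz -expRD; congr expR; ring.
  rewrite mulrA; apply: (le_trans (ler_wpM2r (expR_ge0 _) le2)).
  have -> : A / (1 - a) ^+ 2 = expR (ln A - 2 * ln (1 - a)).
    by rewrite expRB lnK ?posrE // expRM_natl lnK ?posrE.
  by rewrite -expRD ler_expR le_eqVlt; apply/orP; left; apply/eqP; ring.
apply: (le_trans le3).
(* AM-GM with weight a on D and weight 1 - a on A. *)
have := @weighted_amgm_ln bool predT (fun b => if b then a else 1 - a)
           (fun b => if b then D else A).
rewrite !big_bool /= => /(_ _ _ _) amgm.
rewrite -[leRHS]lnK ?posrE ?addr_gt0 // ler_expR [A + D]addrC amgm //.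
- by case=> _; apply: ltW.
- by case.
- by ring.
Qed.

Lemma contraction (a A B C D c : R) : 0 < a <= 1 -> 0 <= A -> 0 <= D ->
  0 <= B -> 0 <= C -> B * C <= A * D ->
  (forall x y, c * expR (a * (x + y)) <=
     A + B * expR x + C * expR y + D * expR (x + y)) ->
  c * entropy_factor a <= A + D.
Proof.
move=> /andP[a0 a1] A0 D0 B0 C0 leBC hc.
apply/ler_addgt0Pr => e e0.
have [a_eq1|a_neq1] := eqVneq a 1.
  rewrite /entropy_factor a_eq1 subrr mul0r ln1 mulr0 addr0 expR0 mulr1.
  (* For a = 1 evaluate at exp x = exp y = T: since T >= 1 and A + B + C <= e T, all terms except D
     T^2 add up to at most e T^2. *)
  set T := (A + B + C) / e + 1.
  have T1 : 1 <= T by rewrite lerDr divr_ge0 ?addr_ge0 // ltW.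
  have T0 : 0 < T by lra.
  have := hc (ln T) (ln T); rewrite a_eq1 mul1r expRD lnK ?posrE // => le1.
  have eT : A + B + C <= e * T by rewrite /T mulrDr mulrC divfK ?gt_eqF //; lra.
  have : c * (T * T) <= (A + D + e) * (T * T).
    apply: le_trans le1 _.
    have : (A + B + C) * T <= e * T * T by rewrite ler_wpM2r // ltW.
    have : 0 <= A * (T * T) by rewrite !mulr_ge0 // ltW.
    have : 0 <= A * (T - 1) by rewrite mulr_ge0 // subr_ge0.
    by nra.
  by rewrite ler_pM2r // mulr_gt0.
(* A or D may vanish, so both are perturbed by e / 2. *)
have e2 : 0 < e / 2 by lra.
rewrite (_ : A + D + e = (A + e / 2) + (D + e / 2)); last by lra.
apply: (@contraction_pos a _ B C); rewrite ?a0 ?lt_neqAle ?a_neq1 ?a1 //=; try lra.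
  by nra.
move=> x y; apply: le_trans (hc x y) _.
by rewrite !lerD // ?ler_wpM2r ?expR_ge0 //; lra.
Qed.

End Inequalities.

(** * Matching sums and correlation *)

Section MatchingSum.
Variables (R : realDomainType) (V : finType).
Implicit Types (w : V -> R) (s : seq (V * V)) (X : {set V}).

(* The edges in the list s have weight 1, and a vertex v that the matching
   leaves uncovered contributes w v. *)
Fixpoint matching_sum w s X : R :=
  if s is e :: s' then
    matching_sum w s' X +
    ((e.1 \in X) && (e.2 \in X))%:R * matching_sum w s' (X :\ e.1 :\ e.2)
  else \prod_(v in X) w v.

Definition multiplicity s u v : R :=
  \sum_(e <- s) ((e == (u, v)) || (e == (v, u)))%:R.

Definition bipartite (side : pred V) s := all (fun e => side e.1 && ~~ side e.2) s.

Lemma setD1C (X : {set V}) u v : X :\ u :\ v = X :\ v :\ u.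
Proof. by rewrite !setDDl setUC. Qed.

Lemma matching_sum_ge0 w s X : (forall v, 0 <= w v) -> 0 <= matching_sum w s X.
Proof.
move=> w0; elim: s X => [|e s IH] X /=; first exact: prodr_ge0.
by rewrite addr_ge0 // mulr_ge0 // ler0n.
Qed.

Lemma eq_in_matching_sum w w' s X : {in X, w =1 w'} ->
  matching_sum w s X = matching_sum w' s X.
Proof.
elim: s X => [|e s IH] X ww' /=; first exact: eq_bigr.
by rewrite !IH // => v; rewrite !inE => /and3P[_ _]; apply: ww'.
Qed.

(** The sum is affine in [w u]: a matching either covers u or carries [w u] as a single factor, and
    the matchings of the second kind are those of X :\ u. *)
Lemma matching_sum_shift w s X u y : u \in X ->
  matching_sum (fun v => w v + (v == u)%:R * y) s X =
  matching_sum w s X + y * matching_sum w s (X :\ u).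
Proof.
elim: s X => [|[a b] s IH] X uX /=.
  rewrite (big_setD1 u) // [in RHS](big_setD1 u) //= eqxx mul1r mulrDl.
  by congr (_ * _ + _ * _); apply: eq_bigr => v /setD1P[/negbTE->]; rewrite mul0r addr0.
have shift0 (Y : {set V}) : u \notin Y ->
    matching_sum (fun v => w v + (v == u)%:R * y) s Y = matching_sum w s Y.
  move=> uY; apply: eq_in_matching_sum => v vY.
  by rewrite (_ : v == u = false) ?mul0r ?addr0 //; apply: contraNF uY => /eqP<-.
rewrite IH // !inE.
have [uab|] := boolP ((u == a) || (u == b)).
  rewrite shift0; last by rewrite !inE; case: eqP uab; case: eqP.
  have -> : [&& (a != u) && (a \in X), b != u & b \in X] = false.
    by rewrite ![_ == u]eq_sym; case: eqP uab => //= _ ->; rewrite andbF.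
  by rewrite mul0r addr0 addrAC.
rewrite negb_or => /andP[ua ub].
rewrite ![_ == u]eq_sym ua ub /= IH ?inE ?ua ?ub //.
rewrite [X :\ u :\ a]setD1C [X :\ a :\ u :\ b]setD1C.
by ring.
Qed.

Lemma sumr_delta (X : {set V}) b (F : V -> R) :
  \sum_(v in X) (v == b)%:R * F v = (b \in X)%:R * F b.
Proof.
have [bX|bX] := boolP (b \in X).
  rewrite (big_setD1 b) //= eqxx big1 ?addr0 // => v /setD1P[/negbTE-> _].
  by rewrite mul0r.
rewrite mul0r big1 // => v vX; rewrite (_ : v == b = false) ?mul0r //.
by apply: contraNF bX => /eqP<-.
Qed.

(** Either u is uncovered or it is matched to some v. Unlike the defining recursion, this expansion
    is taken at a vertex and not at the head of the list. Bipartiteness rules out loops. *)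
Lemma matching_sum_rec side w s X u : bipartite side s -> u \in X ->
  matching_sum w s X = w u * matching_sum w s (X :\ u) +
    \sum_(v in X :\ u) multiplicity s u v * matching_sum w s (X :\ u :\ v).
Proof.
elim: s X => [|[a b] s IH] X /= bs uX.
  rewrite (big_setD1 u) //= [X in _ + X]big1 ?addr0 // => v _.
  by rewrite /multiplicity big_nil mul0r.
case/andP: bs => /andP[sa sb] bs.
have ab : a != b by apply: contraNneq sb => <-.
have mult_cons v : multiplicity ((a, b) :: s) u v =
    ((u == a) && (v == b) || (u == b) && (v == a))%:R + multiplicity s u v.
  rewrite /multiplicity big_cons !xpair_eqE; congr ((nat_of_bool _)%:R + _).
  by rewrite ![a == _]eq_sym ![b == _]eq_sym [(v == a) && _]andbC.
rewrite {1}IH // mulrDr -!addrA; congr (_ + _).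
under [in RHS]eq_bigr do rewrite mult_cons mulrDl.
rewrite !inE.
have [ua|ua] := eqVneq u a.
  subst u.
  rewrite (negbTE ab) /= mul0r mulr0 add0r uX /= addrC.
  under [in RHS]eq_bigr do rewrite !inE eqxx andbF /= mul0r addr0 orbF.
  by rewrite big_split /= sumr_delta !inE eq_sym ab.
have [ub|ub] := eqVneq u b.
  subst u.
  rewrite /= andbF mul0r mulr0 add0r uX andbT addrC setD1C.
  under [in RHS]eq_bigr do rewrite !inE eqxx !andbF mul0r addr0.
  by rewrite big_split /= sumr_delta !inE ab.
rewrite /=.
under [in RHS]eq_bigr do rewrite mul0r add0r mulrDr.
rewrite big_split /= addrCA; congr (_ + _).
have [/andP[aX bX]|abX] := boolP ((a \in X) && (b \in X)); last first.
  rewrite !mul0r mulr0 add0r big1 // => v _.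
  rewrite (_ : _ && _ = false) ?mul0r ?mulr0 //.
  by apply: contraNF abX; rewrite !inE => /andP[/and3P[_ _ ->] /and3P[_ _ ->]].
(* The new edge avoids u, so the matchings using it are themselves expanded at u. *)
rewrite !mul1r IH ?inE ?ua ?ub //; congr (_ * _ + _).
  by rewrite [X :\ u :\ a]setD1C [X :\ a :\ u :\ b]setD1C.
rewrite big_mkcond [RHS]big_mkcond; apply: eq_bigr => v _.
rewrite !inE aX bX ![_ == u]eq_sym ua ub !andbT.
have [uv|uv] := eqVneq u v; first by rewrite /= ?andbF.
have [va|va] := eqVneq v a; first by rewrite /= ?andbF mul0r mulr0 if_same.
have [vb|vb] := eqVneq v b; first by rewrite /= ?andbF mul0r mulr0 if_same.
rewrite /= !mul1r; case: ifP => // _.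
congr (_ * matching_sum _ _ _); apply/setP => x; rewrite !inE.
by case: (x == u); case: (x == v); case: (x == a); case: (x == b).
Qed.

Section Correlation.
Variables (side : pred V) (w : V -> R) (m : V -> V -> R) (Z : {set V} -> R).
Hypothesis m_ge0 : forall u v, 0 <= m u v.
Hypothesis m_side : forall u v, side u = side v -> m u v = 0.
Hypothesis Zrec : forall X u, u \in X ->
  Z X = w u * Z (X :\ u) + \sum_(v in X :\ u) m u v * Z (X :\ u :\ v).

(* Expanding Z at u turns the difference for the pair (u, v) in X into a
   nonnegative combination of the opposite differences for the pairs (x, v) in
   X :\ u, where x is a neighbour of u and so lies on the other side. *)
Lemma correlation X u v : u \in X -> v \in X -> u != v ->
  if side u == side v then Z X * Z (X :\ u :\ v) <= Z (X :\ u) * Z (X :\ v)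
  else Z (X :\ u) * Z (X :\ v) <= Z X * Z (X :\ u :\ v).
Proof.
move: {2}#|X| (erefl #|X|) => n; elim: n X u v => [|n IH] X u v.
  by move/cards0_eq ->; rewrite inE.
move=> Xn uX vX uv; pose H := X :\ u.
have Hn : #|H| = n by apply/eqP; rewrite -eqSS -Xn (cardsD1 u X) uX.
have vH : v \in H by rewrite !inE vX eq_sym uv.
have uXv : u \in X :\ v by rewrite !inE uX uv.
(* Expand [Z X] and [Z (X :\ v)] at u; the terms with [w u] cancel, and v occurs as a neighbour only
   in the first expansion. *)
have diffE : Z X * Z (X :\ u :\ v) - Z (X :\ u) * Z (X :\ v) =
    m u v * Z (H :\ v) ^+ 2 +
    \sum_(x in H :\ v) m u x * (Z (H :\ x) * Z (H :\ v) - Z H * Z (H :\ x :\ v)).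
  rewrite (Zrec uX) (Zrec uXv) -/H [X :\ v :\ u]setD1C -/H.
  rewrite (big_setD1 v) //=.
  under [in RHS]eq_bigr do rewrite mulrBr.
  rewrite sumrB.
  under [in X in _ + (X - _)]eq_bigr do rewrite mulrA.
  rewrite -mulr_suml.
  have -> : \sum_(i in H :\ v) m u i * (Z H * Z (H :\ i :\ v)) =
     Z H * \sum_(i in H :\ v) m u i * Z (H :\ v :\ i).
    rewrite mulr_sumr; apply: eq_bigr => i _; rewrite [H :\ i :\ v]setD1C; ring.
  ring.
case: ifP => suv.
  rewrite -subr_le0 diffE (m_side (eqP suv)) mul0r add0r sumr_le0 // => x xHv.
  have /setD1P[xv xH] := xHv.
  have [sx|sx] := boolP (side u == side x); first by rewrite (m_side (eqP sx)) mul0r.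
  have := IH H x v Hn xH vH xv.
  have -> : (side x == side v) = false.
    by apply: contraNF sx => /eqP->.
  by move=> le; rewrite mulr_ge0_le0 // subr_le0.
rewrite -subr_ge0 diffE addr_ge0 //; first by rewrite mulr_ge0 ?sqr_ge0.
rewrite sumr_ge0 // => x xHv.
have /setD1P[xv xH] := xHv.
have [sx|sx] := boolP (side u == side x); first by rewrite (m_side (eqP sx)) mul0r.
have := IH H x v Hn xH vH xv.
have -> : (side x == side v).
  by move: sx suv; case: (side x); case: (side u); case: (side v).
by move=> le; rewrite mulr_ge0 // subr_ge0.
Qed.

End Correlation.

End MatchingSum.

(** * Gluing half-edges while keeping a lower bound *)

Section Capacity.
Variables (R : realType) (V : finType) (E : eqType) (ends : E -> V * V).

(* Every edge of es is cut into two pendant half-edges, of weights e^(y e) and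
   e^(z e); a vertex is left uncovered or uses one of its half-edges. *)
Definition pendant_weight (w : V -> R) (es : seq E) (y z : E -> R) (v : V) : R :=
  w v + \sum_(e <- es) ((v == (ends e).1)%:R * expR (y e) +
                        (v == (ends e).2)%:R * expR (z e)).

Lemma pendant_weight_ge0 w es y z v : (forall v, 0 <= w v) ->
  0 <= pendant_weight w es y z v.
Proof.
move=> w0; rewrite addr_ge0 ?sumr_ge0 // => e _.
by rewrite addr_ge0 // mulr_ge0 ?ler0n ?expR_ge0.
Qed.

(* Gluing the two halves of one edge back together replaces
   A + B e^y + C e^z + D e^(y+z) by A + D and costs one entropy factor. *)
Lemma capacity_bound (side : pred V) (w : V -> R) es s a c :
  0 < a <= 1 -> (forall v, 0 <= w v) -> uniq es ->
  bipartite side (map ends es) -> bipartite side s ->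
  (forall y z, c * expR (a * \sum_(e <- es) (y e + z e)) <=
     matching_sum (pendant_weight w es y z) s setT) ->
  c * entropy_factor a ^+ size es <= matching_sum w (catrev (map ends es) s) setT.
Proof.
move=> a01 w0; elim: es s c => [|e es IH] s c /=.
  move=> _ _ _ /(_ (fun=> 0) (fun=> 0)); rewrite big_nil mulr0 !expR0 => h.
  by apply: le_trans h _; rewrite le_eqVlt (@eq_in_matching_sum _ _ _ w) ?eqxx // => v _;
     rewrite /pendant_weight big_nil addr0.
case/andP=> e_es ues /andP[bip_e bip_es] bip_s hc.
(* The glued edge moves to the front of s, and c absorbs one entropy factor; the hypothesis must be
   checked again for the new list. *)
rewrite exprS mulrA; apply: IH => //=; first by rewrite bip_e.
move=> y z; rewrite !in_setT mul1r.
set u := (ends e).1; set v := (ends e).2; set w' := pendant_weight w es y z.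
have w'0 x : 0 <= w' x by apply: pendant_weight_ge0.
have uv : side u != side v by case/andP: bip_e => -> /negbTE ->.
have u_neq_v : u != v by apply: contraNneq uv => ->.
(* A, B, C, D are the matching sums on all vertices, without u, without v and without both; A + D is
   the sum with the edge uv glued. *)
rewrite mulrAC; apply: (@contraction _ a _ (matching_sum w' s (setT :\ u))
   (matching_sum w' s (setT :\ v))) => //; rewrite ?matching_sum_ge0 //.
  have := @correlation _ _ side w' (multiplicity R s) (matching_sum w' s).
  move=> /(_ _ _ _ setT u v (in_setT u) (in_setT v) u_neq_v).
  rewrite (negbTE uv); apply=> [x x'|x x' sxx'|X x xX]; last exact: (matching_sum_rec _ bip_s).
    by rewrite sumr_ge0.
  rewrite /multiplicity big_seq big1 // => f /(allP bip_s)/andP[s1 s2].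
  by case: eqP => [f_eq|_]; [|case: eqP => // f_eq]; move: s1 s2;
    rewrite f_eq /= ?sxx' => ->.
move=> x t; have := hc [eta y with e |-> x] [eta z with e |-> t].
have restrict (F : E -> R -> R -> R) :
  \sum_(f <- es) F f ([eta y with e |-> x] f) ([eta z with e |-> t] f) =
  \sum_(f <- es) F f (y f) (z f).
  rewrite big_seq [RHS]big_seq; apply: eq_bigr => f f_es /=.
  by have -> : f == e = false by apply: contraNF e_es => /eqP<-.
rewrite big_cons (restrict (fun _ p q => p + q)) /= eqxx mulrDr expRD => h.
rewrite -[leLHS]mulrA [leLHS](_ : _ = c * (expR (a * (x + t)) * expR (a * \sum_(f <- es) (y f + z f)))); last by ring.
apply: le_trans h _; rewrite le_eqVlt; apply/orP; left; apply/eqP.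
(* The halves of [e] only raise the weights of u and v, so shifting at u and then at v produces the
   four terms. *)
rewrite (@eq_in_matching_sum _ _ _ (fun x' => (w' x' + (x' == u)%:R * expR x)
   + (x' == v)%:R * expR t)); last first.
  move=> x' _; rewrite /pendant_weight big_cons /= eqxx.
  rewrite (restrict (fun f p q => (x' == (ends f).1)%:R * expR p + (x' == (ends f).2)%:R * expR q)).
  by rewrite -/u -/v /w' /pendant_weight; ring.
rewrite matching_sum_shift ?in_setT // matching_sum_shift ?in_setT //.
rewrite matching_sum_shift; last by rewrite !inE u_neq_v.
by rewrite setD1C expRD; ring.
Qed.

End Capacity.

(** * The extra right vertices *)

Lemma sumr_const_pred (R : nmodType) (I : finType) (P : pred I) (c : R) :
  \sum_(i | P i) c = c *+ #|[set i | P i]|.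
Proof. by rewrite -sumr_const; apply: eq_bigl => i; rewrite inE. Qed.

Section CompleteBipartite.
Variables (R : realType) (I J T : finType).
Notation V := (I + (J + T))%type.
Implicit Types (w : V -> R) (X : {set V}).

(* Matching every vertex of T to the left side forces exactly #|T| left vertices
   to be missed by the remaining edges. *)
Definition blank_edges : seq (V * V) :=
  [seq (inl i, inr (inr t)) | i <- enum I, t <- enum T].

Definition left_vertex (v : V) : bool := if v is inl _ then true else false.

Lemma blank_edges_bipartite : bipartite left_vertex blank_edges.
Proof. by apply/allP => _ /allpairsP[[i t] [_ _ ->]]. Qed.

Lemma multiplicity_blank (t : T) v :
  multiplicity R blank_edges (inr (inr t)) v = (left_vertex v)%:R.
Proof.
rewrite /multiplicity big_allpairs_dep /=.
case: v => [i0|v] /=; last by rewrite big1 // => i _; rewrite big1.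
rewrite big_enum /= (bigD1 i0) //= big_enum /= (bigD1 t) //= eqxx [X in 1 + X]big1; last first.
  move=> t' t't; rewrite (_ : (_ == _) = false) //.
  by apply/eqP => -[tt']; rewrite tt' eqxx in t't.
rewrite addr0 big1 ?addr0 // => i ii0; rewrite big1 // => t' _.
rewrite (_ : (_ == _) = false) //.
by apply/eqP => -[ii]; rewrite ii eqxx in ii0.
Qed.

Lemma matching_sum_blank_rec w X t : inr (inr t) \in X ->
  matching_sum w blank_edges X =
  w (inr (inr t)) * matching_sum w blank_edges (X :\ inr (inr t)) +
  \sum_(i | inl i \in X) matching_sum w blank_edges (X :\ inr (inr t) :\ inl i).
Proof.
move=> tX; rewrite (matching_sum_rec _ blank_edges_bipartite tX); congr (_ + _).
rewrite big_sumType /= [X in _ + X]big1 ?addr0; last first.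
  by move=> v _; rewrite multiplicity_blank mul0r.
by apply: eq_big => [i|i _]; rewrite ?inE // multiplicity_blank mul1r.
Qed.

Lemma matching_sum_no_blank w X : (forall t, inr (inr t) \notin X) ->
  matching_sum w blank_edges X = \prod_(v in X) w v.
Proof.
move=> tX; have : {subset blank_edges <= blank_edges} by [].
elim: {1 3}blank_edges => //= e s IH sub.
have /allpairsP[[i t] [_ _ e_eq]] := sub e (mem_head _ _).
rewrite IH => [|f fs]; last by apply: sub; rewrite inE fs orbT.
by rewrite e_eq /= (negbTE (tX t)) andbF mul0r addr0.
Qed.

Lemma blank_setD1 X t i : inr (inr t) \in X -> inl i \in X ->
  #|[set i' | inl i' \in X :\ inr (inr t) :\ inl i]| = #|[set i' | inl i' \in X]|.-1 /\
  #|[set t' | inr (inr t') \in X :\ inr (inr t) :\ inl i]| = #|[set t' | inr (inr t') \in X]|.-1.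
Proof.
move=> tX iX; split.
  rewrite [in RHS](cardsD1 i) !inE iX /=; apply: eq_card => i'.
  by rewrite !inE.
rewrite [in RHS](cardsD1 t) !inE tX /=; apply: eq_card => t'.
by rewrite !inE.
Qed.

(** Weight 0 forces all left and extra vertices of X to be covered, so the sum counts the bijections
    between them. *)
Lemma matching_sum_blank_count w X :
  (forall i, w (inl i) = 0) -> (forall j, w (inr (inl j)) = 1) ->
  (forall t, w (inr (inr t)) = 0) ->
  let N := #|[set i | inl i \in X]| in let b := #|[set t | inr (inr t) \in X]| in
  matching_sum w blank_edges X = (b`! * (N == b))%:R.
Proof.
move=> wl wr wt N b; rewrite {}/N.
have [m b_eq] : {m | b = m} by exists b.
rewrite b_eq; rewrite /b {b} in b_eq *; elim: m X b_eq => [|m IH] X b_eq.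
  rewrite matching_sum_no_blank => [|t]; last first.
    by have /setP/(_ t) := cards0_eq b_eq; rewrite !inE => ->.
  rewrite fact0 mul1n; have [/cards0_eq N0|] := eqVneq; last first.
    by rewrite cards_eq0 => /set0Pn[i]; rewrite inE => iX; rewrite (bigD1 _ iX) /= wl mul0r.
  apply: big1 => -[i|[j|t]] // vX; last by have /setP/(_ t) := cards0_eq b_eq; rewrite !inE vX.
  by have /setP/(_ i) := N0; rewrite !inE vX.
have [t tX] : exists t, inr (inr t) \in X.
  have /card_gt0P[t] : (0 < #|[set t | inr (inr t) \in X]|)%N by rewrite b_eq.
  by rewrite inE => tX; exists t.
rewrite (matching_sum_blank_rec w tX) wt mul0r add0r.
under eq_bigr => i iX.
  have [NE bE] := blank_setD1 tX iX.
  rewrite IH ?NE; last by rewrite bE b_eq.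
  over.
rewrite sumr_const_pred -mulrnA.
case: #|_| => [|N]; first by rewrite !muln0.
rewrite /= eqSS; case: eqP => [->|_]; last by rewrite !muln0.
by rewrite !muln1 factS mulnC.
Qed.

(** The extra vertices can be matched into the left side in [N ^_ b] ways, and each left vertex
    stays uncovered in a fraction (N - b) / N of them; AM-GM over these ways gives the bound. The
    induction matches one extra vertex at a time. *)
Lemma matching_sum_blank_ge w X :
  (forall v, 0 <= w v) -> (forall i, 0 < w (inl i)) ->
  let N := #|[set i | inl i \in X]| in let b := #|[set t | inr (inr t) \in X]| in
  (N ^_ b)%:R * expR ((N%:R - b%:R) / N%:R * \sum_(i | inl i \in X) ln (w (inl i))) *
    \prod_(j | inr (inl j) \in X) w (inr (inl j)) <= matching_sum w blank_edges X.
Proof.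
move=> w0 wl0 /=.
have [m b_eq] : {m | #|[set t | inr (inr t) \in X]| = m} by exists #|[set t | inr (inr t) \in X]|.
rewrite b_eq; elim: m X b_eq => [|m IH] X b_eq.
  have noT t : inr (inr t) \notin X.
    by have /setP/(_ t) := cards0_eq b_eq; rewrite !inE => ->.
  rewrite matching_sum_no_blank // ffactn0 mul1r subr0 !big_sumType /=.
  rewrite [X in _ <= _ * (_ * X)]big_pred0 ?mulr1 => [|t]; last exact/negbTE.
  rewrite ler_wpM2r ?prodr_ge0 //.
  have -> : \prod_(i | inl i \in X) w (inl i) = expR (\sum_(i | inl i \in X) ln (w (inl i))).
    by rewrite expR_sum; apply: eq_bigr => i _; rewrite lnK ?posrE.
  rewrite ler_expR; have [N0|N_neq0] := eqVneq #|[set i | inl i \in X]| 0%N.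
    rewrite N0 invr0 mulr0 mul0r big1 // => i iX.
    by have /setP/(_ i) := cards0_eq N0; rewrite !inE iX.
  by rewrite divff ?mul1r ?pnatr_eq0.
have [lt_N|le_N] := ltnP #|[set i | inl i \in X]| m.+1.
  by rewrite ffact_small // !mul0r matching_sum_ge0.
have [t tX] : exists t, inr (inr t) \in X.
  have /card_gt0P[t] : (0 < #|[set t | inr (inr t) \in X]|)%N by rewrite b_eq.
  by rewrite inE => tX; exists t.
rewrite (matching_sum_blank_rec w tX).
(* The matchings that leave t uncovered are dropped. *)
apply: ler_wpDl; first by rewrite mulr_ge0 // matching_sum_ge0.
set L := \sum_(i | inl i \in X) ln (w (inl i)).
set P := \prod_(j | _) _.
have [N N_eq] : {N | #|[set i | inl i \in X]| = N.+1}.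
  by case: #|_| le_N => // N _; exists N.
rewrite N_eq in le_N *.
set th : R := (N%:R - m%:R) / N%:R.
have le_i i : inl i \in X -> (N ^_ m)%:R * expR (th * (L - ln (w (inl i)))) * P <=
    matching_sum w blank_edges (X :\ inr (inr t) :\ inl i).
  move=> iX; have [NE bE] := blank_setD1 tX iX.
  have := IH (X :\ inr (inr t) :\ inl i); rewrite bE NE b_eq N_eq /= => /(_ erefl).
  apply: le_trans; rewrite le_eqVlt; apply/orP; left; apply/eqP.
  congr (_ * expR (_ * _) * _).
    rewrite /L (bigD1 i) //= addrC addrK; apply: eq_bigl => i'.
    by rewrite !inE /= andbC.
  by apply: eq_bigl => j; rewrite !inE.
apply: le_trans (ler_sum _ le_i); rewrite -mulr_suml -mulr_sumr.
rewrite ler_wpM2r ?prodr_ge0 // ffactSS natrM mulrC mulrA mulrC.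
rewrite ler_wpM2l ?ler0n //.
have cardX : \sum_(i | inl i \in X) (N.+1%:R^-1 : R) = 1.
  rewrite sumr_const_pred N_eq.
  by rewrite -[_ *+ _]mulr_natl divff ?pnatr_eq0.
have := @weighted_amgm_ln R I (fun i => inl i \in X) (fun=> N.+1%:R^-1)
   (fun i => expR (th * (L - ln (w (inl i))))) _ _ cardX.
have iN : (0 : R) < N.+1%:R^-1 by rewrite invr_gt0 ltr0n.
move=> /(_ (fun i _ => ltW iN) (fun i _ => expR_gt0 _)) amgm.
have S0 : 0 < \sum_(i | inl i \in X) expR (th * (L - ln (w (inl i)))).
  have /card_gt0P[i] : (0 < #|[set i | inl i \in X]|)%N by rewrite N_eq.
  rewrite inE => iX; rewrite (bigD1 i) //= ltr_wpDr ?expR_gt0 // sumr_ge0 // => ? _.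
  exact: expR_ge0.
rewrite -[leRHS]lnK ?posrE // -[X in _ * X <= _]lnK ?posrE ?ltr0n // -expRD ler_expR.
apply: le_trans amgm; rewrite -mulr_sumr sumrB.
under [X in _ <= _ * (X - _)]eq_bigr do rewrite expRK.
rewrite -mulr_sumr sumrB -/L.
rewrite !sumr_const_pred N_eq lnV ?posrE ?ltr0n //.
rewrite -[L *+ _]mulr_natl -[(- _) *+ _]mulr_natl.
(* Here [th] is 0 / 0, which evaluates to 0; the exponent to be reached is 0 as well. *)
have [N0|N_neq0] := eqVneq N 0%N.
  have m0 : m = 0%N by lia.
  by rewrite /th N0 m0 ln1 !subrr !mul0r; lra.
(* Averaging L - ln (w i) over the N + 1 choices of i gives N L / (N + 1), and th N / (N + 1) is the
   exponent for N + 1 left and m + 1 extra vertices. *)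
rewrite le_eqVlt; apply/orP; left; apply/eqP; rewrite /th -!natr1.
have N1 : (N%:R + 1 : R) != 0 by rewrite natr1 pnatr_eq0.
have N1' : (N%:R : R) != 0 by rewrite pnatr_eq0.
by field; rewrite N1 N1'.
Qed.

End CompleteBipartite.

(** * The lower bound *)

Section Matchings.
Variables (n : nat) (E : finType) (l r : E -> 'I_n).
Implicit Types M : {set E}.

Lemma is_matchingP M :
  reflect ({in M &, injective l} /\ {in M &, injective r}) (is_matching l r M).
Proof.
apply: (iffP idP) => [mM|[injl injr]].
  have neq e f : e \in M -> f \in M -> e != f -> (l e != l f) && (r e != r f).
    by move=> eM fM; move/forallP: mM => /(_ e)/implyP/(_ eM)/forallP/(_ f)/implyP/(_ fM)/implyP.
  by split=> e f eM fM ef; apply/eqP; apply: contraT => /(neq _ _ eM fM)/andP[];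
     rewrite ef eqxx.
apply/forallP => e; apply/implyP => eM; apply/forallP => f; apply/implyP => fM.
by apply/implyP => ef; rewrite (inj_in_eq injl) // (inj_in_eq injr) // ef.
Qed.

Lemma is_matchingU1 e M : e \notin M ->
  is_matching l r (e |: M) = [&& is_matching l r M, l e \notin l @: M & r e \notin r @: M].
Proof.
move=> eM.
have injU (f : E -> 'I_n) :
    {in e |: M &, injective f} <-> {in M &, injective f} /\ f e \notin f @: M.
  split=> [inj|[inj fe] x y].
    split=> [x y xM yM|]; first by apply: inj; rewrite inE ?xM ?yM orbT.
    apply/imsetP => -[x xM fex]; case/negP: eM.
    by rewrite (inj e x) ?setU11 // setU1r.
  rewrite !inE => /predU1P[->|xM] /predU1P[->|yM] //; last exact: inj.
    by move=> fey; case/negP: fe; rewrite fey imset_f.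
  by move=> fxe; case/negP: fe; rewrite -fxe imset_f.
apply/is_matchingP/and3P => [[/injU[il le] /injU[ir re]]|[/is_matchingP[il ir] le re]].
  by split=> //; apply/is_matchingP.
by split; apply/injU.
Qed.

Variables (R : realDomainType) (T : finType).
Notation V := ('I_n + ('I_n + T))%type.

Definition graph_ends (e : E) : V * V := (inl (l e), inr (inl (r e))).

Definition covered M : {set V} :=
  [set v | match v with
           | inl i => i \in l @: M
           | inr (inl j) => j \in r @: M
           | inr (inr _) => false
           end].

Lemma coveredU1 e M : covered (e |: M) = [set inl (l e); inr (inl (r e))] :|: covered M.
Proof. by apply/setP => -[i|[j|t]]; rewrite !inE ?imsetU1 ?inE ?orbF. Qed.

(** Matchings of the combined graph are sorted by their set M of edges from [es]; the edges of s
    then use vertices outside [covered M]. *)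
Lemma matching_sum_cat (w : V -> R) es s (X : {set V}) : uniq es ->
  matching_sum w (map graph_ends es ++ s) X =
  \sum_(M : {set E} | [&& M \subset es, is_matching l r M & covered M \subset X])
     matching_sum w s (X :\: covered M).
Proof.
elim: es X => [|e es IH] X /=.
  have cov0 M : M = set0 -> covered M = set0 :> {set V}.
    by move=> ->; apply/setP => -[i|[j|t]]; rewrite !inE ?imset0 ?inE.
  move=> _; rewrite (big_pred1 (set0 : {set E})) ?cov0 ?setD0 // => M.
  have -> : (M \subset [::]) = (M == set0).
    by rewrite -subset0; apply: eq_subset_r => x; rewrite !inE.
  case: (boolP (M == set0 :> {set E})) => [M0|/negbTE /= -> //].
  rewrite (cov0 _ (eqP M0)) sub0set andbT /= M0.
  by apply/is_matchingP; split=> x; rewrite (eqP M0) inE.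
case/andP=> e_es ues; rewrite IH // [RHS](bigID [pred M : {set E} | e \in M]) /= [RHS]addrC; congr (_ + _); last first.
  (* The sets containing e are written as e |: M with e outside M, matching the second term of the
     recursion. *)
  rewrite (reindex_onto (fun M => e |: M) (fun M => M :\ e)) /=; last first.
    by move=> M /andP[_ eM]; rewrite setD1K.
  have eqD M : ((e |: M) :\ e == M) = (e \notin M).
    apply/eqP/idP => [<-|]; first by rewrite !inE eqxx.
    exact: setU1K.
  have subM M : e \notin M -> (e |: M \subset e :: es) = (M \subset es).
    move=> eM; apply/subsetP/subsetP => sub x xM.
      have := sub x (setU1r _ xM); rewrite inE => /predU1P[xe|//].
      by rewrite -xe xM in eM.
    by case/setU1P: xM => [->|/sub]; rewrite inE ?eqxx // => ->; rewrite orbT.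
  rewrite IH // big_distrr /= big_mkcond [RHS]big_mkcond /=.
  apply: eq_bigr => M _; rewrite eqD setU11 andbT coveredU1.
  have [eM|eM] := boolP (e \in M).
    rewrite andbF (_ : M \subset es = false) //.
    by apply: contraNF e_es => /subsetP/(_ e eM).
  rewrite subM // is_matchingU1 // andbT subUset.
  have -> : covered M \subset X :\ inl (l e) :\ inr (inl (r e)) =
     [&& covered M \subset X, l e \notin l @: M & r e \notin r @: M].
    by rewrite !subsetD1 !inE -andbA.
  have -> : [set inl (l e); inr (inl (r e))] \subset X = (inl (l e) \in X) && (inr (inl (r e)) \in X).
    by rewrite subUset !sub1set.
  case: (M \subset es) => //=; case: (is_matching l r M) => //=.
  case: (inl _ \in X); rewrite /= ?andbF ?mul0r ?if_same //.
  case: (inr _ \in X); rewrite /= ?andbF ?mul0r ?if_same //.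
  rewrite mul1r [in RHS]andbC; case: ifP => // _.
  congr matching_sum; apply/setP => v; rewrite !inE.
  by case: (_ == _); case: (_ == _); case: (_ \in X); rewrite /= ?andbF ?andbT.
apply: eq_bigl => M; have [eM|eM] := boolP (e \in M).
  rewrite andbF (_ : M \subset es = false) //.
  by apply: contraNF e_es => /subsetP/(_ e eM).
rewrite andbT; congr (_ && _); apply/subsetP/subsetP => sub x xM.
  by rewrite inE sub ?orbT.
have := sub x xM; rewrite inE => /predU1P[xe|//].
by rewrite -xe xM in eM.
Qed.

End Matchings.

(** * AM-GM at each vertex and the resulting lower bound *)

Section LowerBound.
Variable R : realType.

(** Used at the left vertices: uniform weights 1/d on the d half-edges. *)
Lemma ln_sum_expR_ge (I : finType) (P : pred I) (d : nat) (y : I -> R) :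
  (0 < d)%N -> #|[set i | P i]| = d ->
  ln d%:R + d%:R^-1 * \sum_(i | P i) y i <= ln (\sum_(i | P i) expR (y i)).
Proof.
move=> d0 Pd; have dR : (0 : R) < d%:R by rewrite ltr0n.
have lam1 : \sum_(i | P i) (d%:R^-1 : R) = 1.
  by rewrite sumr_const_pred Pd -[_ *+ _]mulr_natl divff ?gt_eqF.
apply: le_trans (weighted_amgm_ln _ _ lam1) => [|i _|i _].
- rewrite -mulr_sumr sumrB sumr_const_pred Pd lnV ?posrE //.
  under [X in _ <= _ * (X - _)]eq_bigr do rewrite expRK.
  by rewrite mulrBr -[- ln _ *+ _]mulr_natl mulrA mulVf ?gt_eqF // mul1r opprK addrC.
- by rewrite invr_ge0 ltW.
- exact: expR_gt0.
Qed.

(** Used at the right vertices: weight 1 - p on staying uncovered, encoded as [None], and p/d on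
    each half-edge. *)
Lemma ln_1_add_sum_expR_ge (I : finType) (P : pred I) (d : nat) (p : R) (z : I -> R) :
  (0 < d)%N -> #|[set i | P i]| = d -> 0 <= p <= 1 ->
  - (p * ln (p / d%:R)) - (1 - p) * ln (1 - p) + p / d%:R * \sum_(i | P i) z i <=
  ln (1 + \sum_(i | P i) expR (z i)).
Proof.
move=> d0 Pd /andP[p0 p1]; have dR : (0 : R) < d%:R by rewrite ltr0n.
pose lam (o : option I) := if o is Some i then p / d%:R else 1 - p.
pose x (o : option I) := if o is Some i then expR (z i) else 1.
pose Q (o : option I) := if o is Some i then P i else true.
have bigQ (F : option I -> R) : \sum_(o | Q o) F o = F None + \sum_(i | P i) F (Some i).
  rewrite (bigD1 None) //=; congr (_ + _).
  rewrite (reindex_omap Some id) /=; last by case.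
  by apply: eq_bigl => i; rewrite eqxx !andbT.
have := @weighted_amgm_ln R _ Q lam x; rewrite !bigQ /=.
have sum_lam : \sum_(i | P i) (p / d%:R) = p.
  by rewrite sumr_const_pred Pd -[_ *+ _]mulr_natr divfK ?gt_eqF.
rewrite sum_lam ln1 => amgm; apply: le_trans (amgm _ _ _).
- rewrite -mulr_sumr sumrB sumr_const_pred Pd.
  under [X in _ <= _ + _ * (X - _)]eq_bigr do rewrite expRK.
  rewrite le_eqVlt; apply/orP; left; apply/eqP.
  rewrite -[ln _ *+ _]mulr_natr; set L := ln (p / d%:R).
  have -> : p / d%:R * (\sum_(i | P i) z i - L * d%:R) =
            p / d%:R * (\sum_(i | P i) z i) - p * L by field; rewrite gt_eqF.
  by ring.
- by case=> [i|] _ /=; [rewrite divr_ge0 // ltW | rewrite subr_ge0].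
- by case=> [i|] _ //=; rewrite ?expR_gt0 ?ltr01.
- by rewrite subrK.
Qed.

Variables (n d k : nat) (E : finType) (l r : E -> 'I_n).
Hypotheses (d_gt0 : (0 < d)%N) (k_gt0 : (0 < k)%N) (k_le_n : (k <= n)%N).
Hypothesis regular : regular_bip d l r.

Let T := 'I_(n - k).
Notation V := ('I_n + ('I_n + T))%type.

(** Left and extra vertices are forced to be covered; right vertices are free. *)
Let w0 (v : V) : R := if v is inr (inl _) then 1 else 0.

Lemma card_edges : #|E| = (n * d)%N.
Proof.
rewrite -sum1_card (partition_big l predT) //=.
rewrite (eq_bigr (fun=> d)) ?sum_nat_const ?card_ord // => i _.
by rewrite sum1_card -(proj1 regular i) cardsE.
Qed.

(** A matching of size k misses n - k left vertices, which the extra vertices cover in (n - k)!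
    ways; any other size contributes 0. *)
Lemma matching_sum_num_matchings :
  matching_sum w0 (catrev (map (@graph_ends _ _ l r T) (enum E)) (blank_edges 'I_n 'I_n T)) setT
  = ((n - k)`! * num_matchings l r k)%:R.
Proof.
rewrite catrevE -map_rev matching_sum_cat ?rev_uniq ?enum_uniq //.
rewrite (eq_bigr (fun M : {set E} => (n - k)`!%:R * (#|M| == k)%:R)); last first.
  move=> M /and3P[_ /is_matchingP[injl _] _].
  rewrite matching_sum_blank_count // natrM.
  have -> : [set t | inr (inr t) \in [set: V] :\: covered l r T M] = setT.
    by apply/setP => t; rewrite !inE.
  have -> : [set i | inl i \in [set: V] :\: covered l r T M] = ~: (l @: M).
    by apply/setP => i; rewrite !inE andbT.
  have := cardsC (l @: M); rewrite cardsT !card_ord (card_in_imset injl) => cardM.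
  by congr (_ * (nat_of_bool _)%:R); apply/eqP/eqP; lia.
rewrite -mulr_sumr -natr_sum natrM; congr (_ * _%:R).
rewrite /num_matchings -sum1dep_card big_mkcond [RHS]big_mkcond /=.
apply: eq_bigr => M _; rewrite subsetT andbT (_ : M \subset _) /=.
  by case: is_matching; case: eqP.
by apply/subsetP => e _; rewrite mem_rev mem_enum.
Qed.

(** Both sides of the split graph yield the same exponent a = p/d: a left half-edge gets 1/d from
    its vertex, scaled by the power p left by the extra vertices, and a right half-edge gets p/d
    directly. *)
Lemma num_matchings_ge (p : R) : p = k%:R / n%:R ->
  'C(n, k)%:R * expR (k%:R * ln d%:R - (n%:R - k%:R) * ln (1 - p)
                      + (n%:R * d%:R - k%:R) * ln (1 - p / d%:R))
  <= (num_matchings l r k)%:R.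
Proof.
move=> p_eq; have n_gt0 : (0 < n)%N := leq_trans k_gt0 k_le_n.
have nR : (0 : R) < n%:R by rewrite ltr0n.
have dR : (0 : R) < d%:R by rewrite ltr0n.
have kR : (0 : R) < k%:R by rewrite ltr0n.
have d1 : (1 : R) <= d%:R by rewrite ler1n.
have p_gt0 : 0 < p by rewrite p_eq divr_gt0.
have p_le1 : p <= 1 by rewrite p_eq ler_pdivrMr // mul1r ler_nat.
have np : n%:R * p = k%:R by rewrite p_eq mulrC divfK ?gt_eqF.
pose a : R := p / d%:R.
have a01 : 0 < a <= 1 by rewrite divr_gt0 //= ler_pdivrMr // mul1r (le_trans p_le1).
pose c : R := (n ^_ (n - k))%:R *
  expR (k%:R * ln d%:R + n%:R * (- (p * ln a) - (1 - p) * ln (1 - p))).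
have w0_ge0 v : 0 <= w0 v by case: v => [i|[j|t]] //=; rewrite ler01.
have bip_G : bipartite (@left_vertex 'I_n 'I_n T) (map (@graph_ends _ _ l r T) (enum E)).
  by apply/allP => _ /mapP[e _ ->].
have := @capacity_bound R V E (@graph_ends _ _ l r T) _ w0 (enum E) (blank_edges 'I_n 'I_n T) a c
  a01 w0_ge0 (enum_uniq _) bip_G (blank_edges_bipartite _ _ _).
rewrite matching_sum_num_matchings -cardE card_edges => cap.
have fact_gt0 : (0 : R) < (n - k)`!%:R by rewrite ltr0n fact_gt0.
rewrite -(ler_pM2l fact_gt0) -[leRHS]natrM.
apply: le_trans (cap _).
  have binE : (n - k)`!%:R * 'C(n, k)%:R = (n ^_ (n - k))%:R :> R.
    by rewrite -natrM mulnC -(bin_sub k_le_n) bin_ffact.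
  rewrite mulrA binE /c -mulrA.
  rewrite ler_wpM2l ?ler0n // /entropy_factor -expRM_natl -expRD ler_expR.
  rewrite le_eqVlt; apply/orP; left; apply/eqP.
  by rewrite natrM -/a -np /a; field; rewrite gt_eqF.
move=> y z; set w := pendant_weight _ _ _ _ _.
have w_left i : w (inl i) = \sum_(e | l e == i) expR (y e).
  rewrite /w /pendant_weight /= add0r big_enum /= [RHS]big_mkcond.
  apply: eq_bigr => e _; rewrite mul0r addr0.
  have -> : (inl i == inl (l e) :> V) = (l e == i) by rewrite eq_sym.
  by case: ifP; rewrite ?mul1r ?mul0r.
have w_right j : w (inr (inl j)) = 1 + \sum_(e | r e == j) expR (z e).
  rewrite /w /pendant_weight /= big_enum /= [in RHS]big_mkcond; congr (_ + _).
  apply: eq_bigr => e _; rewrite mul0r add0r.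
  have -> : (inr (inl j) == inr (inl (r e)) :> V) = (r e == j) by rewrite eq_sym.
  by case: ifP; rewrite ?mul1r ?mul0r.
have sum_l (F : E -> R) : \sum_i \sum_(e | l e == i) F e = \sum_e F e.
  by rewrite [RHS](partition_big l predT).
have sum_r (F : E -> R) : \sum_j \sum_(e | r e == j) F e = \sum_e F e.
  by rewrite [RHS](partition_big r predT).
have [reg_l reg_r] := regular.
have w_left_gt0 i : 0 < w (inl i).
  rewrite w_left; have /card_gt0P[e] : (0 < #|[set e | l e == i]|)%N by rewrite reg_l.
  rewrite inE => el; rewrite (bigD1 e) //= ltr_wpDr ?expR_gt0 // sumr_ge0 // => ? _.
  exact: expR_ge0.
have w_right_gt0 j : 0 < w (inr (inl j)).
  by rewrite w_right ltr_wpDr ?ltr01 // sumr_ge0 // => ? _; exact: expR_ge0.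
have w_ge0 v : 0 <= w v by apply: pendant_weight_ge0.
have := matching_sum_blank_ge setT w_ge0 w_left_gt0.
apply: le_trans.
have -> : #|[set i | inl i \in [set: V]]| = n.
  by rewrite (_ : [set _ | _] = setT) ?cardsT ?card_ord //; apply/setP => ?; rewrite !inE.
have -> : #|[set t | inr (inr t) \in [set: V]]| = (n - k)%N.
  by rewrite (_ : [set _ | _] = setT) ?cardsT ?card_ord //; apply/setP => ?; rewrite !inE.
have -> : (n%:R - (n - k)%:R) / n%:R = p by rewrite p_eq natrB // opprB addrCA subrr addr0.
rewrite /c -mulrA -[leRHS]mulrA ler_wpM2l ?ler0n // -expRD.
rewrite (eq_bigl xpredT) => [|j]; last by rewrite in_setT.
rewrite [X in _ <= expR (p * X) * _](eq_bigl xpredT) => [|i]; last by rewrite in_setT.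
have -> : \prod_j w (inr (inl j)) = expR (\sum_j ln (w (inr (inl j)))).
  by rewrite expR_sum; apply: eq_bigr => j _; rewrite lnK ?posrE.
rewrite -expRD ler_expR big_enum /= big_split /= mulrDr.
have le_l : p * (n%:R * ln d%:R + d%:R^-1 * \sum_e y e) <= p * \sum_i ln (w (inl i)).
  rewrite ler_wpM2l ?(ltW p_gt0) //.
  have -> : n%:R * ln d%:R = \sum_(i < n) ln d%:R :> R by rewrite sumr_const card_ord mulr_natl.
  rewrite -sum_l mulr_sumr -big_split ler_sum //= => i _.
  by rewrite w_left ln_sum_expR_ge.
have le_r : n%:R * (- (p * ln a) - (1 - p) * ln (1 - p)) + a * \sum_e z e <=
     \sum_j ln (w (inr (inl j))).
  rewrite mulr_natl -{1}[n]card_ord -sumr_const -sum_r mulr_sumr -big_split ler_sum //= => j _.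
  by rewrite w_right ln_1_add_sum_expR_ge // (ltW p_gt0).
apply: le_trans (lerD le_l le_r); rewrite le_eqVlt; apply/orP; left; apply/eqP.
by rewrite -np /a; field; rewrite gt_eqF.
Qed.

End LowerBound.

(** * Monotonicity of the binomial mode *)

Section BinomialMonotonicity.
Variable R : realType.

(** Multiplying the cubic truncation for n by 1 + x exceeds the one for n + 1 by exactly n (n - 1)
    (n - 2) / 6 x^4. *)
Lemma binomial_lower_bound3 (x : R) (n : nat) : 0 <= x ->
  1 + n%:R * x + n%:R * (n%:R - 1) / 2 * x ^+ 2
    + n%:R * (n%:R - 1) * (n%:R - 2) / 6 * x ^+ 3 <= (1 + x) ^+ n.
Proof.
move=> x0; elim: n => [|n IH]; first by rewrite !mul0r !addr0 expr0.
have x1 : 0 <= 1 + x by rewrite addr_ge0.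
rewrite [(1 + x) ^+ _]exprS; apply: le_trans (ler_wpM2l x1 IH); rewrite -subr_ge0.
have c3 : 0 <= n%:R * (n%:R - 1) * (n%:R - 2) :> R.
  case: n {IH} => [|[|n]]; rewrite ?mul0r ?subrr ?mulr0 ?mul0r //.
  rewrite -[n.+2%:R]natr1 -natr1 !mulr_ge0 //; have := ler0n R n; lra.
have x4 : 0 <= n%:R * (n%:R - 1) * (n%:R - 2) / 6 * x ^+ 4.
  by rewrite mulr_ge0 ?exprn_ge0 // mulr_ge0 // invr_ge0.
rewrite (_ : _ - _ = n%:R * (n%:R - 1) * (n%:R - 2) / 6 * x ^+ 4) //.
by rewrite -natr1; field.
Qed.

(* Taking logarithms, the claim is that (1 + x) ^ (2 m + 1) >= ((m + 2) / (m + 1)) ^ 2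
   for x = 1 / (m (m + 2)); the quadratic binomial expansion of the left-hand side is not enough,
   the cubic one is. *)
Lemma half_shift_ln_antitone (m : nat) : (0 < m)%N ->
  (m.+1%:R + 2^-1) * (ln m.+2%:R - ln m.+1%:R) <= (m%:R + 2^-1) * (ln m.+1%:R - ln (m%:R : R)).
Proof.
move=> m0; have mR : (1 : R) <= m%:R by rewrite ler1n.
rewrite -[m.+2%:R]natr1 -[m.+1%:R]natr1; set t : R := m%:R.
have t1 : 1 <= t by [].
pose x := (t * (t + 2))^-1.
have tt : 0 < t * (t + 2) by rewrite mulr_gt0; lra.
have x0 : 0 < x by rewrite invr_gt0.
have /(le_trans _) := binomial_lower_bound3 (2 * m).+1 (ltW x0).
rewrite -natr1 natrM -/t => /(_ (((t + 2) / (t + 1)) ^+ 2)) pow_ge.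
have {pow_ge} : ((t + 2) / (t + 1)) ^+ 2 <= (1 + x) ^+ (2 * m).+1.
  apply: pow_ge; rewrite -subr_ge0.
  have -> : 1 + (2 * t + 1) * x + (2 * t + 1) * (2 * t + 1 - 1) / 2 * x ^+ 2 +
     (2 * t + 1) * (2 * t + 1 - 1) * (2 * t + 1 - 2) / 6 * x ^+ 3 -
      ((t + 2) / (t + 1)) ^+ 2 =
    (t ^+ 4 + 5 * t ^+ 3 + 18 * t ^+ 2 + 16 * t - 1) /
      (3 * t ^+ 2 * (t + 2) ^+ 3 * (t + 1) ^+ 2).
    by rewrite /x; field; rewrite !gt_eqF //; lra.
  rewrite divr_ge0 ?mulr_ge0 ?exprn_ge0 //; try lra.
  have := exprn_ge0 4 (le_trans ler01 t1); have := exprn_ge0 3 (le_trans ler01 t1).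
  have := exprn_ge0 2 (le_trans ler01 t1); lra.
(* In this form the logarithm of the power inequality is twice the claim, rearranged. *)
have -> : 1 + x = (t + 1) / t * ((t + 1) / (t + 2)).
  by rewrite /x; field; rewrite !gt_eqF //; lra.
have [p0 p1 p2] : [/\ 0 < t, 0 < t + 1 & 0 < t + 2] by split; lra.
rewrite -ler_ln ?posrE ?exprn_gt0 ?mulr_gt0 ?divr_gt0 ?invr_gt0 //.
rewrite !lnXn ?mulr_gt0 ?divr_gt0 ?invr_gt0 // !lnM ?lnV ?posrE ?divr_gt0 ?invr_gt0 //.
rewrite -[X in _ <= X -> _]mulr_natl -[(2 * m).+1%:R]natr1 natrM -/t -[t + 1 + 1]addrA.
by rewrite (_ : 1 + 1 = 2 :> R) // mulr2n => ?; nra.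
Qed.

(* Up to a term depending only on k, the logarithm of
   sqrt (1 - q) * P (Binomial (N, q) = k) at q = k / N. *)
Definition ln_binomial_mode k (N : nat) : R :=
  ln 'C(N, k)%:R - k%:R * ln N%:R
  + (N%:R - k%:R + 2^-1) * (ln (N - k)%:R - ln N%:R).

Lemma half_shift_ln_le (m M : nat) : (0 < m)%N -> (m <= M)%N ->
  (M%:R + 2^-1) * (ln M.+1%:R - ln M%:R) <= (m%:R + 2^-1) * (ln m.+1%:R - ln (m%:R : R)).
Proof.
move=> m0; elim: M => [|M IH]; first by rewrite leqn0 => /eqP m_eq; rewrite m_eq in m0.
rewrite leq_eqVlt => /predU1P[-> //|mM].
by apply: le_trans (IH mM); apply: half_shift_ln_antitone; apply: leq_trans m0 mM.
Qed.

(** With m = N - k the increment is exactly (m + 1/2) ln ((m + 1) / m) - (N + 1/2) ln ((N + 1) /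
    N). *)
Lemma ln_binomial_mode_le k N : (k < N)%N ->
  ln_binomial_mode k N <= ln_binomial_mode k N.+1.
Proof.
move=> kN; have N0 : (0 < N)%N by apply: leq_ltn_trans kN.
have Nk0 : (0 < N - k)%N by rewrite subn_gt0.
have := half_shift_ln_le Nk0 (leq_subr k N).
have binE : ln 'C(N.+1, k)%:R = ln N.+1%:R + ln 'C(N, k)%:R - ln (N - k).+1%:R :> R.
  rewrite -lnM ?posrE ?ltr0n ?bin_gt0 ?(ltnW kN) // -ln_div ?posrE ?ltr0n ?muln_gt0 ?bin_gt0 ?(ltnW kN) //; last first.
    by rewrite -natrM ltr0n muln_gt0 bin_gt0 (ltnW kN).
  congr ln; apply: (mulIf (x := (N - k).+1%:R)); rewrite ?pnatr_eq0 // divfK ?pnatr_eq0 //.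
  by rewrite -!natrM (mul_bin_down N.+1 k) subSn ?(ltnW kN) // mulnC.
rewrite /ln_binomial_mode binE subSn ?(ltnW kN) // natrB ?(ltnW kN) //.
have N1 : N.+1%:R = N%:R + 1 :> R by rewrite natr1.
rewrite !N1; set a := ln (N%:R + 1); set b := ln (N - k).+1%:R.
set N' := N%:R; set k' := k%:R.
rewrite -subr_ge0 => h; rewrite -subr_ge0.
by lra.
Qed.

Lemma ln_binomial_mode_homo k N N' : (k < N)%N -> (N <= N')%N ->
  ln_binomial_mode k N <= ln_binomial_mode k N'.
Proof.
move=> kN; elim: N' => [|N' IH]; first by rewrite leqn0 => /eqP->.
rewrite leq_eqVlt => /predU1P[-> //|NN'].
by apply: le_trans (IH NN') _; apply: ln_binomial_mode_le; apply: leq_trans kN NN'.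
Qed.

End BinomialMonotonicity.

(** * Both bounds in exponential form *)

Section Assembly.
Variable R : realType.
Implicit Types (d n k : nat) (p : R).

(** For p = k/n this is p_mu exp(2n G_d(p)) with the powers of p cancelled, so that no logarithm of
    p remains. *)
Definition matching_bound d n k p : R :=
  'C(n, k)%:R * expR (k%:R * ln d%:R - (n%:R - k%:R) * ln (1 - p)
                      + (n%:R * d%:R - k%:R) * ln (1 - p / d%:R)).

Lemma matching_bound_ge0 d n k p : 0 <= matching_bound d n k p.
Proof. by rewrite mulr_ge0 ?ler0n ?expR_ge0. Qed.

Lemma matching_bound_le d n k (E : finType) (l r : E -> 'I_n) p :
  (0 < d)%N -> (k <= n)%N -> regular_bip d l r -> p = k%:R / n%:R ->
  matching_bound d n k p <= (num_matchings l r k)%:R.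
Proof.
move=> d0 kn reg p_eq; have [k0|k_gt0] := posnP k; last exact: num_matchings_ge.
(* For k = 0 the exponent a would vanish; the bound equals 1 and the empty matching attains it. *)
rewrite /matching_bound p_eq k0 bin0 !mul0r !subr0 ln1 !mulr0 subr0 addr0 expR0 mulr1 ler1n.
apply/card_gt0P; exists set0; rewrite inE cards0 eqxx andbT.
by apply/is_matchingP; split=> x; rewrite inE.
Qed.

(** In logarithms this compares [ln_binomial_mode] at n and at n d: 1 - p and 1 - p/d are (n - k)/n
    and (nd - k)/(nd), and k ln d is k ln (nd) - k ln n. *)
Lemma few_matchings_le d n k (c : nat) p :
  (0 < d)%N -> (k < n)%N -> p = k%:R / n%:R ->
  (c * 'C(n * d, k) <= ('C(n, k) * d ^ k) ^ 2)%N ->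
  c%:R <= Num.sqrt ((1 - p / d%:R) / (1 - p)) * matching_bound d n k p.
Proof.
move=> d0 kn p_eq c_le.
have n0 : (0 < n)%N by apply: leq_ltn_trans kn.
have n_nd : (n <= n * d)%N by rewrite leq_pmulr.
have k_nd : (k < n * d)%N by apply: leq_trans n_nd.
have [nR dR ndR] : [/\ (0 : R) < n%:R, (0 : R) < d%:R & (0 : R) < (n * d)%:R].
  by rewrite !ltr0n muln_gt0 n0 d0.
have C0 : (0 : R) < 'C(n, k)%:R by rewrite ltr0n bin_gt0 ltnW.
have Cd0 : (0 : R) < 'C(n * d, k)%:R by rewrite ltr0n bin_gt0 ltnW.
have nk : (0 : R) < (n - k)%:R by rewrite ltr0n subn_gt0.
have ndk : (0 : R) < (n * d - k)%:R by rewrite ltr0n subn_gt0.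
have p1E : 1 - p = (n - k)%:R / n%:R.
  by rewrite p_eq natrB ?(ltnW kn) //; field; rewrite gt_eqF.
have pdE : 1 - p / d%:R = (n * d - k)%:R / (n * d)%:R.
  by rewrite p_eq natrB ?(ltnW k_nd) // natrM; field; rewrite !gt_eqF.
have mode := ln_binomial_mode_homo R kn n_nd.
have p1 : 0 < 1 - p by rewrite p1E divr_gt0.
have pd1 : 0 < 1 - p / d%:R by rewrite pdE divr_gt0.
have -> : Num.sqrt ((1 - p / d%:R) / (1 - p)) =
    expR (2^-1 * (ln (1 - p / d%:R) - ln (1 - p))).
  rewrite -ln_div ?posrE // -[X in Num.sqrt X]lnK ?posrE ?divr_gt0 //.
  set z := ln _; rewrite (_ : expR z = expR (2^-1 * z) ^+ 2).
    by rewrite sqrtr_sqr ger0_norm ?expR_ge0.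
  by rewrite -expRM_natl mulrA divff ?mul1r ?pnatr_eq0.
have le1 : c%:R <= expR (2 * (ln 'C(n, k)%:R + k%:R * ln d%:R) - ln 'C(n * d, k)%:R) :> R.
  rewrite expRB lnK ?posrE // ler_pdivlMr // expRM_natl expRD lnK ?posrE //.
  by rewrite expRM_natl lnK ?posrE // -natrX -!natrM -natrX ler_nat.
apply: (le_trans le1); rewrite /matching_bound -[X in _ <= _ * (X * _)]lnK ?posrE // -!expRD ler_expR.
move: mode; rewrite /ln_binomial_mode p1E pdE !ln_div ?posrE //.
rewrite [in ln (n * d)%:R]natrM lnM ?posrE // natrM; lra.
Qed.

Lemma binomial_mass_le1 n k p : (k <= n)%N -> 0 <= p <= 1 ->
  'C(n, k)%:R * p ^+ k * (1 - p) ^+ (n - k) <= 1.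
Proof.
move=> kn /andP[p0 p1]; have q0 : 0 <= 1 - p by rewrite subr_ge0.
have := exprDn (1 - p) p n; rewrite subrK expr1n => one; rewrite [leRHS]one.
rewrite (bigD1 (Ordinal (kn : (k < n.+1)%N))) //= -mulrA [p ^+ k * _]mulrC mulr_natl.
by rewrite lerDl sumr_ge0 // => i _; rewrite mulrn_wge0 // mulr_ge0 ?exprn_ge0.
Qed.

Lemma binomial_mass_expR n k p : (k <= n)%N -> (0 < n)%N -> p = k%:R / n%:R ->
  p ^+ k * (1 - p) ^+ (n - k) = expR (k%:R * ln p + (n%:R - k%:R) * ln (1 - p)).
Proof.
move=> kn n0 p_eq; have nR : (0 : R) < n%:R by rewrite ltr0n.
rewrite expRD -natrB // !expRM_natl; congr (_ * _).
  (* A base vanishes only together with its exponent, and both sides then give 1. *)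
  have [->|k0] := posnP k; first by rewrite !expr0.
  by rewrite lnK // posrE p_eq divr_gt0 // ltr0n.
have [->|nk0] := posnP (n - k); first by rewrite !expr0.
by rewrite lnK // posrE p_eq subr_gt0 ltr_pdivrMr // mul1r ltr_nat -subn_gt0.
Qed.

End Assembly.

(** With a total logarithm, the convention for a zero factor holds automatically. *)
Lemma xlnE (a b : R) : xln a b = a * exp.ln b.
Proof. by rewrite /xln RlnE; case: RIneq.Req_EM_T => //= a0; rewrite a0 mul0r. Qed.

Local Close Scope ring_scope.
Delimit Scope ring_scope with ring.
Delimit Scope R_scope with R.


(** * Random regular bipartite multigraphs *)

Section PermutationAveraging.
Variable E : finType.
Implicit Types (M T : {set E}) (L : {set {set E}}).

(** List M before its complement and T before its complement, and match the two lists position by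
    position. *)
Lemma perm_imset_ex M T : #|M| = #|T| -> exists s : {perm E}, s @: M = T.
Proof.
move=> MT; pose order (A : {set E}) := enum A ++ enum (~: A).
have mem_order A x : x \in order A by rewrite mem_cat !mem_enum inE orbN.
have uniq_order A : uniq (order A).
  rewrite cat_uniq !enum_uniq andbT /=; apply/hasPn => x.
  by rewrite !mem_enum inE.
have size_order A : size (order A) = #|E| by rewrite size_cat -!cardE cardsC.
pose f x := nth x (order T) (index x (order M)).
have lt_index x : index x (order M) < size (order T).
  by rewrite size_order -(size_order M) index_mem.
have f_inj : injective f.
  move=> x y /eqP; rewrite /f (set_nth_default y) // nth_uniq // => /eqP eq_index.
  by rewrite -(nth_index x (mem_order M x)) eq_index nth_index.
exists (perm f_inj); apply/eqP; rewrite eqEcard card_imset ?MT ?leqnn ?andbT; last exact: perm_inj.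
apply/subsetP => _ /imsetP[x xM ->]; rewrite permE /f.
have xeM : x \in enum M by rewrite mem_enum.
rewrite /order index_cat xeM nth_cat -cardE -MT cardE index_mem xeM.
by rewrite -mem_enum mem_nth // -cardE -MT cardE index_mem.
Qed.

(** All sets of size |M| are hit by equally many permutations, since composing with one that carries
    A to T is a bijection between the two families. *)
Lemma card_perm_imset M T : #|M| = #|T| ->
  #|[set s : {perm E} | s @: M == T]| * 'C(#|E|, #|M|) = #|{perm E}|.
Proof.
move=> MT; rewrite -[RHS]sum1_card (partition_big (fun s : {perm E} => s @: M)
    (fun A : {set E} => #|A| == #|M|)) /=; last first.
  by move=> s _; rewrite card_imset //; apply: perm_inj.
rewrite mulnC -card_draws -sum_nat_const.
rewrite [LHS](eq_bigl (fun A : {set E} => #|A| == #|M|)) => [|A]; last by rewrite inE.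
apply: eq_bigr => A /eqP cardA; rewrite sum1dep_card.
have [s sA] : exists s : {perm E}, s @: A = T by apply: perm_imset_ex; rewrite cardA.
rewrite -!sum1dep_card (reindex_inj (mulIg s)); apply: eq_bigl => t.
have -> : (t * s)%g @: M = s @: (t @: M).
  by rewrite -imset_comp; apply: eq_imset => x; rewrite permM.
rewrite -sA; apply/eqP/eqP => [|-> //]; apply: imset_inj; exact: perm_inj.
Qed.

(** Averaging: counting triples (s, M, T) with s(M) = T, the left-hand side has mean exactly |L|^2
    over all s, so it cannot exceed |L|^2 everywhere. *)
Lemma perm_few_intersections L k : (forall M, M \in L -> #|M| = k) ->
  exists s : {perm E},
    #|[set M in L | s @: M \in L]| * 'C(#|E|, k) <= #|L| * #|L|.
Proof.
move=> cardL; apply/existsP; apply: contraT; rewrite negb_exists => /forallP many.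
have : \sum_(s : {perm E}) (#|L| * #|L|) <
       \sum_(s : {perm E}) #|[set M in L | s @: M \in L]| * 'C(#|E|, k).
  rewrite (bigD1 1%g) //= [X in _ < X](bigD1 1%g) //= -addSn leq_add //.
    by rewrite ltnNge many.
  by apply: leq_sum => s _; rewrite ltnW // ltnNge many.
rewrite sum_nat_const -big_distrl /=.
have -> : \sum_(s : {perm E}) #|[set M in L | s @: M \in L]| =
    \sum_(M in L) \sum_(T in L) #|[set s : {perm E} | s @: M == T]|.
  have card_sum (s : {perm E}) : #|[set M in L | s @: M \in L]| =
      \sum_(M in L) \sum_(T in L) (s @: M == T).
    rewrite -sum1dep_card big_mkcondr; apply: eq_bigr => M _.
    case: ifPn => [sM|sM]; last by rewrite big1 // => T TL; case: eqP sM => // ->; rewrite TL.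
    by rewrite (bigD1 (s @: M)) //= eqxx big1 // => T /andP[_ /negbTE]; rewrite eq_sym => ->.
  rewrite (eq_bigr _ (fun s _ => card_sum s)) exchange_big; apply: eq_bigr => M _.
  rewrite exchange_big; apply: eq_bigr => T _.
  by rewrite -sum1dep_card [RHS]big_mkcond; apply: eq_bigr => s _; case: eqP.
rewrite big_distrl (eq_bigr (fun=> #|L| * #|{perm E}|)) /=.
  by rewrite sum_nat_const mulnC -mulnA ltnn.
move=> M ML; rewrite big_distrl /= -sum_nat_const; apply: eq_bigr => T TL.
by rewrite -(cardL M ML) card_perm_imset // !cardL.
Qed.

End PermutationAveraging.

(** * The pairing model: each of the n vertices on either side has d half-edges *)

Section RandomRegular.
Variables (n d : nat).
Notation E := ('I_n * 'I_d)%type.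

(* The second condition makes the left endpoints of the k edges distinct. *)
Definition partial_sections k : {set {set E}} :=
  [set M : {set E} | (#|M| == k) && (#|[set e.1 | e in M]| == k)].

(** Such an M is the graph of a function to 'I_d on its k-set S of left vertices. *)
Lemma card_partial_sections k : 0 < d -> #|partial_sections k| <= 'C(n, k) * d ^ k.
Proof.
move=> d_gt0; pose y0 := Ordinal d_gt0.
pose graph (S : {set 'I_n}) (f : {ffun 'I_n -> 'I_d}) : {set E} :=
  [set e | (e.1 \in S) && (e.2 == f e.1)].
rewrite -sum1_card (partition_big (fun M : {set E} => [set e.1 | e in M])
   (fun S => #|S| == k)) /=; last by move=> M; rewrite inE => /andP[].
rewrite -[n in 'C(n, k)]card_ord -card_draws -sum_nat_const.
rewrite [leqRHS](eq_bigl (fun S : {set 'I_n} => #|S| == k)) => [|S]; last by rewrite inE.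
apply: leq_sum => S /eqP cardS.
(* Functions are fixed to [y0] outside S, so that exactly d^k remain. *)
have <- : #|pffun_on y0 (mem S) predT| = d ^ k by rewrite card_pffun_on cardS card_ord.
rewrite sum1dep_card; apply: leq_trans (leq_imset_card (graph S) _).
apply/subset_leq_card/subsetP => M; rewrite !inE => /andP[/andP[/eqP cM /eqP cpM] /eqP SM].
have injM : {in M &, injective (fun e : E => e.1)} by apply/imset_injP; rewrite cM cpM.
pose f := [ffun i => if [pick e in M | e.1 == i] is Some e then e.2 else y0].
have fM e : e \in M -> f e.1 = e.2.
  move=> eM; rewrite ffunE; case: pickP => [e' /andP[e'M /eqP e1]|/(_ e)].
    by rewrite (injM _ _ e'M eM e1).
  by rewrite eM eqxx.
apply/imsetP; exists f.
  apply/pffun_onP; split=> //; apply/subsetP => i; rewrite inE ffunE -SM.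
  case: pickP => [e /andP[eM /eqP <-] _|_]; first exact: imset_f.
  by rewrite eqxx.
apply/setP => e; rewrite inE -SM; apply/idP/andP => [eM|[/imsetP[e' e'M e1] /eqP e2]].
  by rewrite imset_f // fM.
by rewrite (_ : e = e') //; case: e e1 e2 => a b /= -> ->; rewrite fM //; case: e' {e'M}.
Qed.

Lemma regular_perm (s : {perm E}) :
  regular_bip d (fun e : E => e.1) (fun e : E => (s e).1).
Proof.
have card_fiber i : #|[set e : E | e.1 == i]| = d.
  rewrite (_ : [set _ | _] = setX [set i] [set: 'I_d]).
    by rewrite cardsX cards1 cardsT card_ord mul1n.
  by apply/setP => -[a b]; rewrite !inE andbT.
split=> j //; rewrite -[RHS](card_fiber j).
rewrite -(card_imset _ (@perm_inj _ s)); apply: eq_card => e.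
apply/imsetP/idP => [[e']|]; rewrite inE; first by move=> ? ->; rewrite inE.
by move=> ej; exists ((s^-1)%g e); rewrite ?inE permKV.
Qed.

(** When half-edge e on the left is paired with s e on the right, a matching M of size k makes both
    M and s(M) partial sections. *)
Lemma exists_regular_few_matchings k : 0 < d ->
  exists r : E -> 'I_n, regular_bip d (fun e : E => e.1) r /\
    num_matchings (fun e : E => e.1) r k * 'C(n * d, k) <= ('C(n, k) * d ^ k) ^ 2.
Proof.
move=> d_gt0.
have cardL M : M \in partial_sections k -> #|M| = k.
  by rewrite inE => /andP[/eqP].
have [s few] := perm_few_intersections cardL.
exists (fun e => (s e).1); split; first exact: regular_perm.
rewrite card_prod !card_ord in few.
have leL := card_partial_sections k d_gt0.
apply: leq_trans (leq_mul leL leL); apply: leq_trans few; rewrite leq_mul2r; apply/orP; right.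
apply/subset_leq_card/subsetP => M; rewrite !inE => /andP[/is_matchingP[injl injr] /eqP cM].
rewrite (card_in_imset injl) (card_imset _ (@perm_inj _ s)) cM eqxx /=.
by rewrite -imset_comp (card_in_imset injr) cM.
Qed.

End RandomRegular.

(** * Translation to the reals of the statement *)

Lemma p_mu_exp_Gd d n k (p : R) : 0 < d -> 0 < n -> k <= n -> p = (INR k / INR n)%R ->
  (p_mu n k p * exp (2 * INR n * Gd d p))%R = matching_bound d n k p.
Proof.
rewrite !RealsE => d0 n0 kn p_eq.
have nR : (0 < n%:R :> R)%ring by rewrite ltr0n.
have dR : (0 < d%:R :> R)%ring by rewrite ltr0n.
have np : (n%:R * p = k%:R)%ring by rewrite p_eq mulrC divfK ?gt_eqF.
rewrite /p_mu /Gd !xlnE !RealsE -[nat_of_pos 2]/2%N -[(_ * _ * _ ^+ _)%ring]mulrA.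
rewrite binomial_mass_expR // -mulrA -expRD /matching_bound; congr (_ * expR _)%ring.
(* The factor p is kept because the identity for the logarithms alone fails at p = 0. *)
have -> : (p * ln (d%:R / p) = p * (ln d%:R - ln p))%ring.
  have [k_eq0|k0] := posnP k; first by rewrite p_eq k_eq0 !mul0r.
  by rewrite ln_div // posrE p_eq divr_gt0 // ltr0n.
by rewrite -np; field.
Qed.

(** A zero base occurs only with exponent 0 (p = 0, or d = p = 1), where [Rpower] returns 1 as 0^0
    requires. *)
Lemma binomial_sq_Rpower d n k (p : R) : 0 < d -> 0 < n -> k <= n -> p = (INR k / INR n)%R ->
  (INR 'C(n, k) ^ 2 * Rpower ((INR d - p) / INR d) (INR n * (INR d - p))
     * Rpower (INR d * p) (INR n * p))%R = (p_mu n k p * matching_bound d n k p)%R.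
Proof.
rewrite !RealsE => d0 n0 kn p_eq.
have nR : (0 < n%:R :> R)%ring by rewrite ltr0n.
have dR : (0 < d%:R :> R)%ring by rewrite ltr0n.
have np : (n%:R * p = k%:R)%ring by rewrite p_eq mulrC divfK ?gt_eqF.
rewrite /p_mu /Rpower !RealsE.
have -> : ((d%:R - p) / d%:R = 1 - p / d%:R)%ring by field; rewrite gt_eqF.
have -> : (n%:R * p * ln (d%:R * p) = n%:R * p * (ln d%:R + ln p))%ring.
  rewrite np; have [->|k0] := posnP k; first by rewrite !mul0r.
  by rewrite lnM // posrE p_eq divr_gt0 // ltr0n.
rewrite -[X in (X * matching_bound _ _ _ _)%ring]mulrA binomial_mass_expR // /matching_bound.
rewrite expr2 -!mulrA; congr (_ * _)%ring; rewrite [RHS]mulrCA; congr (_ * _)%ring.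
by rewrite -!expRD -np; congr expR; ring.
Qed.

Theorem theorem1p5 (d n : nat) (hd : (1 <= d)%nat) (hn : (1 <= n)%nat) :
  (forall k : nat, (k <= n)%nat ->
     forall (E : finType) (l r : E -> 'I_n), regular_bip d l r ->
       let p := (INR k / INR n)%R in
       (p_mu n k p * exp (2 * INR n * Gd d p) <= INR (num_matchings l r k))%R)
  /\
  (forall k : nat, (k <= n)%nat ->
     forall (E : finType) (l r : E -> 'I_n), regular_bip d l r ->
       let p := (INR k / INR n)%R in
       (INR 'C(n, k) ^ 2
          * Rpower ((INR d - p) / INR d) (INR n * (INR d - p))
          * Rpower (INR d * p) (INR n * p)
        <= INR (num_matchings l r k))%R)
  /\
  (forall k : nat, (k < n)%nat ->
     exists (E : finType) (l r : E -> 'I_n), regular_bip d l r /\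
       let p := (INR k / INR n)%R in
       (INR (num_matchings l r k)
          <= sqrt ((1 - p / INR d) / (1 - p)) * p_mu n k p
             * exp (2 * INR n * Gd d p))%R).
Proof.
have p_E k : (INR k / INR n)%R = (k%:R / n%:R)%ring by rewrite !RealsE.
have lower k (E : finType) (l r : E -> 'I_n) : k <= n -> regular_bip d l r ->
    (matching_bound d n k (INR k / INR n)%R <= (num_matchings l r k)%:R)%ring.
  by move=> kn reg; apply: matching_bound_le.
split; [|split].
- move=> k kn E l r reg p; apply/RleP.
  by rewrite p_mu_exp_Gd // INRE; apply: lower.
- move=> k kn E l r reg p; apply/RleP.
  rewrite binomial_sq_Rpower // INRE; apply: le_trans (lower k E l r kn reg).
  have p01 : (0 <= p <= 1)%ring.
    rewrite /p p_E divr_ge0 ?ler0n //=.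
    by rewrite ler_pdivrMr ?ltr0n // mul1r ler_nat.
  rewrite RmultE ler_piMl ?matching_bound_ge0 //.
  by rewrite /p_mu !RealsE binomial_mass_le1.
move=> k kn; have [r [reg few]] := exists_regular_few_matchings n k hd.
exists ('I_n * 'I_d)%type, fst, r; split=> // p; apply/RleP.
rewrite Rmult_assoc p_mu_exp_Gd ?(ltnW kn) // /p !RealsE.
exact: few_matchings_le.
Qed.
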